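(* Let $X$ be a real topological-linear space, $Y$ a real locally convex space, $\Omega\subseteq X$ nonempty, $f:X\to Y$, and $K\subseteq Y$ a nontrivial cone. Let $\bar x\in\mathrm{PEff}_{He}(\Omega\mid f,K)$, i.e., there is $D\in\mathcal D(K)$ such that $\bar x\in\mathrm{Eff}(\Omega\mid f,D)$. Suppose that $D$ is closed. Define $\bar D:=Y\setminus(-\operatorname{int}D)$. Assume that $B_K(\psi)$ and $B_{\bar D}(\psi)$ are normlike-bases for $K$ and $\bar D$, respectively, constructed with respect to a continuous seminorm $\psi:Y\to\mathbb R$. Suppose that $\operatorname{cl}S_{-K}(\psi)$ is compact, and $$(\operatorname{cl}S^0_{\bar D}(\psi))\cap(\operatorname{cl}S_{-K}(\psi))=\emptyset.$$ Then there is $(x^*,\alpha)\in K^{a\#}(\psi)\cap(Y^*\times\mathbb P)$ such that, with $C:=C_\psi(x^*,\alpha)$, $\bar x\in\mathrm{Eff}(\Omega\mid f,C)$. Moreover, if $C\neq\ell(C)$ and $\varphi:Y\to\mathbb R$ is a sublinear functional with $\varphi(0)=0$ which is $-C$ representing, then: (i) for any $k\in C\setminus\ell(C)$, $\{(x,0)\mid x\in\Omega,\ f(x)=f(\bar x)\}$ is the set of solutions of $(P_\varphi^{a,k})$ for $a=f(\bar x)$; (ii) $\{x\in\Omega\mid f(x)=f(\bar x)\}=\operatorname{argmin}_{x\in\Omega}\varphi(f(x)-f(\bar x))$; (iii) if $\mathcal P\subseteq Y$, $\mathcal T\subseteq C\setminus\ell(C)$, $\mathcal R\subseteq\mathbb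 R$ satisfy $f[\mathrm{Eff}(\Omega\mid f,C)]\subseteq\mathcal P+\mathcal R\cdot\mathcal T$, then there are $a\in\mathcal P$, $k\in\mathcal T$, $s\in\mathcal R$ so that $\{(x,s)\mid x\in\Omega,\ f(x)=f(\bar x)\}$ is the set of solutions of $(P_\varphi^{a,k})$; (iv) if, in addition to the assumption in (iii), $C$ is closed, then there are $a\in\mathcal P$, $k\in\mathcal T$, $s\in\mathcal R$ so that $\varphi^G_{a-C,k}(f(\bar x))=s$ and $\{x\in\Omega\mid f(x)=f(\bar x)\}=\operatorname{argmin}_{x\in\Omega}\varphi^G_{a-C,k}(f(x))$.
   Context: $Y^*$ is the topological dual of $Y$, $\mathbb R_+=[0,\infty)$, $\mathbb P=(0,\infty)$. A set $K\subseteq Y$ is a cone if $0\in K=\mathbb R_+\cdot K$ (not necessarily convex); it is nontrivial if $\{0\}\ne K\ne Y$; $\ell(K):=K\cap(-K)$. $\mathcal D(K)$ is the family of all nontrivial, convex cones $D\subseteq Y$ with $K\setminus\{0\}\subseteq\operatorname{int}D$. $\mathrm{Eff}(\Omega\mid f,C)$ is the set of $\bar x\in\Omega$ for which there is no $x\in\Omega$ with $f(x)\in f(\bar x)-(C\setminus\{0\})$; $\mathrm{PEff}_{He}(\Omega\mid f,K)$ is the set of $\bar x\in\Omega$ such that $\bar x\in\mathrm{Eff}(\Omega\mid f,D)$ for some $D\in\mathcal D(K)$. For a cone $M$: $B_M(\psi):=\{x\in M\mid\psi(x)=1\}$, $S_M(\psi):=\operatorname{conv}(B_M(\psi))$, $S^0_M(\psi):=\operatorname{conv}(\{0\}\cup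 B_M(\psi))$; $B_M(\psi)$ is a normlike-base for the nontrivial cone $M$ if $\psi>0$ on $M\setminus\{0\}$. $K^{a\#}(\psi):=\{(x^*,\alpha)\in Y^*\times\mathbb R_+\mid\forall y\in K\setminus\{0\}:\ x^*(y)-\alpha\psi(y)>0\}$. $C_\psi(x^*,\alpha):=\{y\in Y\mid x^*(y)\ge\alpha\psi(y)\}$. $\varphi$ is $-C$ representing if $-C=\{y\in Y\mid\varphi(y)\le0\}$. $f[M]$ is the image of $M$. $(P_\varphi^{a,k})$ is the problem: minimize $\lambda$ subject to $\varphi(f(x)-a-\lambda k)\le0$, $(x,\lambda)\in\Omega\times\mathbb R$; a solution is a feasible pair with $\lambda$ minimal among all feasible pairs. $\varphi^G_{a-C,k}(y):=\inf\{t\in\mathbb R\mid y\in tk+(a-C)\}\in\mathbb R\cup\{\pm\infty\}$ ($\inf\emptyset=+\infty$). *)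

(* Defs.v *)
From HB Require Import structures.
From mathcomp Require Import all_boot all_order all_algebra.
From mathcomp Require Import all_classical all_reals all_analysis.

Set Implicit Arguments.
Unset Strict Implicit.
Unset Printing Implicit Defensive.

Import Order.TTheory GRing.Theory Num.Theory.
Import numFieldNormedType.Exports.

Local Open Scope classical_set_scope.
Local Open Scope ring_scope.

Section cones.
Context (R : realType) (Y : lmodType R).
Implicit Types K C : set Y.

(* Cones are not assumed convex. *)
Definition is_cone K : Prop :=
  K 0 /\ K = [set t *: y | t in [set t : R | 0 <= t] & y in K].

Definition nontrivial_cone K : Prop :=
  is_cone K /\ K <> [set 0] /\ K <> [set: Y].

Definition lineality C : set Y := C `&` (-%R @` C).

Definition conv (A : set Y) : set Y :=
  smallest (fun M : set Y => convex_set (M : set (convex_lmodType Y))) A.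

(* Nonnegativity follows from these two properties. *)
Definition seminorm (psi : Y -> R) : Prop :=
  (forall x y, psi (x + y) <= psi x + psi y) /\
  (forall (t : R) x, psi (t *: x) = `|t| * psi x).

Definition sublinear (phi : Y -> R) : Prop :=
  (forall x y, phi (x + y) <= phi x + phi y) /\
  (forall (t : R) x, 0 < t -> phi (t *: x) = t * phi x).

(* B_M(psi), S_M(psi) and S^0_M(psi) *)
Definition base (M : set Y) (psi : Y -> R) : set Y :=
  [set x | M x /\ psi x = 1].

Definition conv_base (M : set Y) (psi : Y -> R) : set Y :=
  conv (base M psi).

Definition conv_base0 (M : set Y) (psi : Y -> R) : set Y :=
  conv ([set 0] `|` base M psi).

Definition normlike_base (M : set Y) (psi : Y -> R) : Prop :=
  nontrivial_cone M /\ (forall x, M x -> x <> 0 -> 0 < psi x).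

Definition minus_representing (C : set Y) (phi : Y -> R) : Prop :=
  -%R @` C = [set y | phi y <= 0].

(* The Gerstewitz functional phi^G_{A,k}; its infimum over the empty set is +oo. *)
Definition gerstewitz (A : set Y) (k y : Y) : \bar R :=
  ereal_inf [set t%:E | t in [set t : R | [set t *: k + z | z in A] y]].

End cones.

Section topological_cones.
Context (R : realType) (Y : tvsType R).

Definition top_dual : set {linear Y -> R^o} :=
  [set l | continuous (l : Y -> R^o)].

(* The augmented dual cone K^{a#}(psi) *)
Definition aug_dual_sharp (K : set Y) (psi : Y -> R) :
    set ({linear Y -> R^o} * R) :=
  [set p | (top_dual `*` [set alpha | 0 <= alpha]) p /\
    forall y, (K `\ 0) y -> 0 < p.1 y - p.2 * psi y].

(* The Bishop-Phelps type cone C_psi(x^*, alpha), with p = (x^*, alpha) *)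
Definition bp_cone (psi : Y -> R) (p : {linear Y -> R^o} * R) : set Y :=
  [set y | p.2 * psi y <= p.1 y].

Definition dilating_cones (K : set Y) : set (set Y) :=
  [set D | [/\ nontrivial_cone D,
               convex_set (D : set (convex_lmodType Y)) &
               K `\ 0 `<=` D°]].

End topological_cones.

Definition argmin {d : Order.disp_t} {T : porderType d} {I : Type}
    (A : set I) (g : I -> T) : set I :=
  [set x | A x /\ forall x', A x' -> (g x <= g x')%O].

Section efficiency.
Context (R : realType) (X : Type) (Y : tvsType R).
Variables (Omega : set X) (f : X -> Y).

Definition Eff (C : set Y) : set X :=
  [set xbar | Omega xbar /\
    ~ exists2 x, Omega x & [set f xbar - c | c in C `\ 0] (f x)].

Definition PEff_He (K : set Y) : set X :=
  [set xbar | exists2 D, dilating_cones K D & Eff D xbar].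

(* Pascoletti-Serafini problem (P_phi^{a,k}): the minimized objective is lambda, the second
   component of a feasible pair. *)
Definition ps_feasible (phi : Y -> R) (a k : Y) : set (X * R) :=
  [set p | Omega p.1 /\ phi (f p.1 - a - p.2 *: k) <= 0].

Definition ps_solutions (phi : Y -> R) (a k : Y) : set (X * R) :=
  argmin (ps_feasible phi a k) snd.

End efficiency.

(* Main.v *)
(* Strict separation of conv_base (- K) from conv_base0 (~` (- int D)) by a continuous linear
   functional l gives alpha > 0 with l < - alpha on the former set and - alpha < l on the latter.
   By homogeneity, the first inequality is l > alpha psi on K \ {0}, and the second says that
   l y >= alpha psi y with y <> 0 forces - y to lie in - int D; so C \ {0} is contained in D and
   efficiency passes from D to C.  For (i)-(iv), with f xbar = a + s k, a point x feasible at level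
   t <= s satisfies f xbar - f x = (t k + a - f x) + (s - t) k in C, hence f x = f xbar by
   efficiency, and then (t - s) k in C forces t = s because - k is not in C.

   The separation theorem comes from a Hahn-Banach theorem for convex cones F of Y * R that
   contain no (0, a) with a < 0: a maximal such cone is the epigraph of a linear functional. *)
Require Import Defs.
From HB Require Import structures.
From mathcomp Require Import all_boot all_order all_algebra.
From mathcomp Require Import all_classical all_reals all_analysis.
From mathcomp Require Import ring lra.

Set Implicit Arguments.
Unset Strict Implicit.
Unset Printing Implicit Defensive.

Import Order.TTheory GRing.Theory Num.Theory.
Import numFieldNormedType.Exports.

Local Open Scope classical_set_scope.
Local Open Scope ring_scope.

(** * Convex sets and convex hulls *)

Lemma convex_setD (R : realType) (Y : lmodType R) (A : set Y) :
  convex_set (A : set (convex_lmodType Y)) ->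
  forall x y s t, A x -> A y -> 0 <= s -> 0 <= t ->
  exists2 z, A z & s *: x + t *: y = (s + t) *: z.
Proof.
move=> cA x y s t Ax Ay s0 t0.
have [st0|st0] := eqVneq (s + t) 0.
  exists x => //; have -> : s = 0 by lra.
  have -> : t = 0 by lra.
  by rewrite addr0 !scale0r addr0.
have stp : 0 < s + t by rewrite lt_neqAle eq_sym st0 addr_ge0.
(* Dividing by [s + t] turns the sum into a convex combination with weight [s / (s + t)]. *)
have l01 : 0 <= s / (s + t) <= 1.
  by rewrite divr_ge0 ?(ltW stp)// ler_pdivrMr// mul1r lerDl.
have [l0 l1] := andP l01.
have lE : 1 - s / (s + t) = t / (s + t) by field.
have := cA x y (Itv01 l0 l1) (mem_set Ax) (mem_set Ay).
move=> /set_mem; exists ((s / (s + t)) *: x + (t / (s + t)) *: y).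
  by rewrite -lE.
by rewrite scalerDr !scalerA !(mulrC (s + t)) !divfK.
Qed.

Lemma conv_convex (R : realType) (Y : lmodType R) (A : set Y) :
  convex_set (Defs.conv A : set (convex_lmodType Y)).
Proof.
move=> x y l /set_mem Ax /set_mem Ay; apply/mem_set => B BA.
by apply/set_mem/(BA.1); apply/mem_set; [exact: Ax|exact: Ay].
Qed.

Lemma sub_conv (R : realType) (Y : lmodType R) (A : set Y) : A `<=` Defs.conv A.
Proof. by move=> x Ax B [_]; apply. Qed.

(** * Hahn-Banach theorem for cones in [Y * R] *)

Definition epi_cone (R : realType) (Y : lmodType R) (F : set (Y * R)) : Prop :=
  [/\ forall x y a b, F (x, a) -> F (y, b) -> F (x + y, a + b),
      forall t x a, 0 < t -> F (x, a) -> F (t *: x, t * a) &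
      forall a, F (0, a) -> 0 <= a].

Lemma maximal_epi_cone (R : realType) (Y : lmodType R) (E : set (Y * R)) :
  epi_cone E -> E (0, 0) ->
  exists F, [/\ E `<=` F, epi_cone F &
    forall G, epi_cone G -> F `<=` G -> G = F].
Proof.
move=> Econe E0.
(* The guard [F !=set0] admits the empty set, which is the union of the empty chain. *)
pose P (F : set (Y * R)) := epi_cone F /\ (F !=set0 -> E `<=` F).
have [C CP Ctot|F [[Fcone EF] Fmax]] := @Zorn_bigcup _ P.
  split; last first.
    move=> [p [F CF Fp]] e Ee; exists F => //.
    by apply: (CP _ CF).2 => //; exists p.
  split.
  - move=> x y a b [F CF Fx] [G CG Gy].
    have [/= FG|GF] := Ctot _ _ CF CG.
      by exists G => //; have [GD _ _] := (CP _ CG).1; apply: GD Gy; exact: FG.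
    by exists F => //; have [FD _ _] := (CP _ CF).1; apply: FD Fx _; exact: GF.
  - by move=> t x a t0 [F CF Fx]; exists F => //; have [_ FZ _] := (CP _ CF).1; exact: FZ.
  - by move=> a [F CF Fa]; have [_ _ F0] := (CP _ CF).1; exact: F0.
have max G : P G -> F `<=` G -> G = F.
  move=> PG FG; apply/seteqP; split=> //.
  by apply: contrapT => nGF; apply: (Fmax G) => //; split.
(* [E] itself satisfies [P], so an empty maximal [F] would equal [E], which contains [(0, 0)]. *)
have F0 : F !=set0.
  have [-> //|] := pselect (F = E); first by exists (0, 0).
  move=> FE; apply: contrapT => nF; apply: FE; apply/esym/max; first by split=> // _ x.
  by move=> p Fp; case: nF; exists p.
exists F; split=> //; first exact: EF.
move=> G Gcone FG; apply: max => //; split => // _.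
exact: subset_trans (EF F0) FG.
Qed.

(* A maximal cone is a closed half-space: a pair that cannot be added to it yields, after
   normalization, a pair of the opposite half-space. *)
Lemma maximal_epi_cone_dichotomy (R : realType) (Y : lmodType R)
    (F : set (Y * R)) :
  epi_cone F -> F (0, 0) ->
  (forall G, epi_cone G -> F `<=` G -> G = F) ->
  forall x a, F (x, a) \/ exists2 b, b < - a & F (- x, b).
Proof.
move=> [FD FZ F0] F00 Fmax x a.
(* The cone generated by [F] and [(x, a)]. *)
pose G := [set p | exists y b t, [/\ F (y, b), 0 <= t &
  p = (y + t *: x, b + t * a)]].
have FG : F `<=` G.
  by move=> [y b] Fy; exists y, b, 0; rewrite scale0r mul0r !addr0.
have [Gpos|] := pselect (forall c, G (0, c) -> 0 <= c).
  left; suff <- : G = F by exists 0, 0, 1; rewrite scale1r mul1r !add0r.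
  apply: Fmax => //.
  split=> //.
  - move=> _ _ _ _ [y1 [b1 [t1 [Fy1 t10 [-> ->]]]]] [y2 [b2 [t2 [Fy2 t20 [-> ->]]]]].
    exists (y1 + y2), (b1 + b2), (t1 + t2).
    by rewrite addr_ge0// scalerDl mulrDl !addrA !(addrAC _ _ y2) !(addrAC _ _ b2);
      split=> //; exact: FD.
  - move=> r _ _ r0 [y [b [t [Fy t0 [-> ->]]]]].
    exists (r *: y), (r * b), (r * t).
    by rewrite mulr_ge0 ?(ltW r0)// scalerDr mulrDr scalerA mulrA; split=> //; exact: FZ.
move=> /existsNP[c /not_implyP[[y [b [t [Fy t0 [/esym yE cE]]]]]]] /negP.
rewrite -ltNge cE => bneg; right.
have tp : 0 < t.
  rewrite lt_neqAle t0 andbT; apply/eqP => t0E; move: yE bneg Fy.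
  rewrite -t0E scale0r mul0r !addr0 => -> b0 /F0.
  by rewrite leNgt b0.
exists (t^-1 * b); first by rewrite mulrC ltr_pdivrMr//; lra.
have -> : - x = t^-1 *: y.
  move/eqP : yE; rewrite addr_eq0 => /eqP ->.
  by rewrite scalerN scalerA mulVf ?gt_eqF// scale1r.
by apply: FZ => //; rewrite invr_gt0.
Qed.

(** The functional is the infimum of the fibre over [x] of a maximal cone containing [E]. The cone
    axioms make it subadditive and positively homogeneous; the dichotomy makes it odd, hence
    linear. *)
Lemma hahn_banach_cone (R : realType) (Y : lmodType R) (E : set (Y * R)) :
  epi_cone E -> E (0, 0) -> (forall x, exists a, E (x, a)) ->
  exists l : {linear Y -> R^o}, forall x a, E (x, a) -> l x <= a.
Proof.
move=> Econe E0 Etot.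
have [F [EF Fcone Fmax]] := maximal_epi_cone Econe E0.
have F00 := EF _ E0.
have Fdich := maximal_epi_cone_dichotomy Fcone F00 Fmax.
have [FD FZ F0] := Fcone.
have Ftot x : exists a, F (x, a) by have [a /EF] := Etot x; exists a.
pose l (x : Y) : R := inf [set a | F (x, a)].
have Flb x : has_lbound [set a | F (x, a)].
  have [b Fb] := Ftot (- x); exists (- b) => a /= Fa.
  by have := FD _ _ _ _ Fa Fb; rewrite subrr => /F0; lra.
have Finf x : has_inf [set a | F (x, a)] by split; [exact: Ftot|exact: Flb].
have lle x a : F (x, a) -> l x <= a by exact: ge_inf.
have lD x y : l (x + y) <= l x + l y.
  apply/ler_addgt0Pr => e e0; have e2 : 0 < e / 2 by lra.
  have [a Fa ale] := inf_adherent e2 (Finf x).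
  have [b Fb ble] := inf_adherent e2 (Finf y).
  have := lle _ _ (FD _ _ _ _ Fa Fb); rewrite -/(l x) -/(l y) in ale ble; lra.
have lZ t x : 0 < t -> l (t *: x) <= t * l x.
  move=> t0; rewrite -ler_pdivrMl//; apply: lb_le_inf; first exact: Ftot.
  by move=> a /= Fa; rewrite ler_pdivrMl//; apply: lle; exact: FZ.
have lN x : l (- x) = - l x.
  apply/eqP; rewrite eq_le; apply/andP; split; last first.
    have := lD x (- x); rewrite subrr.
    have : 0 <= l 0 by apply: lb_le_inf; [exact: Ftot|exact: F0].
    lra.
  (* A level [a] strictly between [- l (- x)] and [l x] contradicts both alternatives of the
     dichotomy. *)
  rewrite lerNr leNgt; apply/negP => /midf_lt [+ +].
  set a := (_ / _) => al lx.
  have [/lle|[b ba /lle]] := Fdich x a; lra.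
have lDE x y : l (x + y) = l x + l y.
  apply/eqP; rewrite eq_le lD /=.
  by have := lD (x + y) (- y); rewrite addrK lN; lra.
have l0 : l 0 = 0 by have := lDE 0 0; rewrite addr0; lra.
have lZp t x : 0 < t -> l (t *: x) = t * l x.
  move=> t0; apply/eqP; rewrite eq_le lZ//=.
  by have := lZ _ (- x) t0; rewrite scalerN !lN; lra.
have lZE t x : l (t *: x) = t * l x.
  have [t0|t0|->] := ltgtP t 0; last by rewrite scale0r mul0r.
    have := lZp (- t) x; rewrite scaleNr lN; lra.
  exact: lZp.
have lin : linear (l : Y -> R^o) by move=> t x y; rewrite lDE lZE.
pose L := GRing.isLinear.Build R Y R^o _ l lin.
pose ll : {linear Y -> R^o} := HB.pack (l : Y -> R^o) L.
by exists ll => x a /EF; exact: lle.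
Qed.

(** * Continuity and separation in locally convex spaces *)

Lemma linear_bounded_continuous (R : realType) (Y : tvsType R)
    (l : {linear Y -> R^o}) (U : set Y) :
  nbhs 0 U -> (forall u, U u -> l u <= 1) -> continuous (l : Y -> R^o).
Proof.
move=> U0 lU x; apply/cvgrPdist_le => /= e e0.
have near_scaled c : \forall y \near x, U (c *: (y - x)).
  suff : (fun y => c *: (y - x)) @ x --> (0 : Y) by move=> /(_ _ U0).
  have -> : 0 = c *: (x - x) by rewrite subrr scaler0.
  apply: (@continuous_comp Y Y Y (fun y => y - x) ( *:%R c)).
    apply: (@continuous_comp Y (Y * Y)%type Y (fun y => (y, - x))
      (fun z => z.1 + z.2)); last exact: add_continuous.
    by apply: cvg_pair; [exact: cvg_id|exact: cvg_cst].
  apply: (@continuous_comp Y (R^o * Y)%type Y (fun y => (c, y))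
    (fun z => z.1 *: z.2)); last exact: scale_continuous.
  by apply: (@cvg_pair _ _ _ _ (nbhs (c : R^o))); [exact: cvg_cst|exact: cvg_id].
near=> y.
(* The one-sided bound on [U], applied to both signs of [e^-1 *: (y - x)], bounds [l (y - x)] in
   absolute value by [e]. *)
have /lU : U (e^-1 *: (y - x)) by near: y; exact: near_scaled.
have /lU : U ((- e^-1) *: (y - x)) by near: y; exact: near_scaled.
rewrite !linearZ /= [l (y - x)]linearB /= -![_ *: _]/(_ * _) mulNr lerNl.
rewrite ler_pdivlMl// ler_pdivrMl// => h1 h2.
by rewrite ler_norml; lra.
Unshelve. all: by end_near. Qed.

Lemma nbhs0_absorbing (R : realType) (Y : tvsType R) (U : set Y) :
  nbhs 0 U -> forall x, exists2 s : R, 0 < s & U (s *: x).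
Proof.
move=> U0 x.
have : (fun s : R^o => s *: x) @ 0 --> (0 : Y).
  rewrite -[0 in X in _ --> X](scale0r x).
  apply: (@continuous_comp R^o (R^o * Y)%type Y (fun s => (s, x))
    (fun z => z.1 *: z.2)); last exact: scale_continuous.
  by apply: (@cvg_pair _ _ _ _ (nbhs (0 : R^o))); [exact: cvg_id|exact: cvg_cst].
move=> /(_ _ U0) /= [e /= e0 eU]; exists (e / 2); first by rewrite divr_gt0.
by apply: eU => /=; rewrite sub0r normrN gtr0_norm; lra.
Qed.

Lemma separation_nbhs0 (R : realType) (Y : tvsType R) (U M : set Y) :
  convex_set (U : set (convex_lmodType Y)) ->
  convex_set (M : set (convex_lmodType Y)) ->
  nbhs 0 U -> U `&` M = set0 -> M !=set0 ->
  exists2 l : {linear Y -> R^o}, continuous (l : Y -> R^o) &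
    forall m, M m -> 1 <= l m.
Proof.
move=> cU cM nU UM [m0 Mm0].
have U0 : U 0 := nbhs_singleton nU.
(* The epigraph cone generated by (u, 1) and (- m, - 1): bounding l by it gives both the
   continuity of l (l <= 1 on U) and l >= 1 on M. *)
pose E := [set p : Y * R | exists u m s t, [/\ U u, M m, 0 <= s, 0 <= t &
  p = (s *: u - t *: m, s - t)]].
have Ei u m s t : U u -> M m -> 0 <= s -> 0 <= t ->
    E (s *: u - t *: m, s - t) by move=> *; exists u, m, s, t.
have Econe : epi_cone E.
  split.
  - move=> _ _ _ _ [u1 [m1 [s1 [t1 [Uu1 Mm1 s10 t10 [-> ->]]]]]]
      [u2 [m2 [s2 [t2 [Uu2 Mm2 s20 t20 [-> ->]]]]]].
    rewrite (addrACA (s1 *: u1)) (addrACA s1) -!opprD.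
    have [u Uu ->] := convex_setD cU Uu1 Uu2 s10 s20.
    have [m Mm ->] := convex_setD cM Mm1 Mm2 t10 t20.
    by apply: Ei => //; exact: addr_ge0.
  - move=> r _ _ r0 [u [m [s [t [Uu Mm s0 t0 [-> ->]]]]]].
    rewrite scalerBr mulrBr !scalerA.
    by apply: Ei => //; rewrite mulr_ge0 ?(ltW r0).
  - move=> _ [u [m [s [t [Uu Mm s0 t0 [/esym/subr0_eq sutm ->]]]]]].
    rewrite leNgt; apply/negP => st.
    (* As [0] is in [U], convexity writes [s *: u + (t - s) *: 0] as [t *: v] with [v] in [U]; then
       [m = v] lies in both [U] and [M]. *)
    have [v Uv] := convex_setD (t := t - s) cU Uu U0 s0 ltac:(lra).
    rewrite scaler0 addr0 addrC subrK sutm => /scalerI mv.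
    have : (U `&` M) m by split=> //; rewrite mv// gt_eqF//; lra.
    by rewrite UM.
have Etot x : exists a, E (x, a).
  have [s s0 Usx] := nbhs0_absorbing nU x; exists s^-1.
  have si0 : 0 <= s^-1 by rewrite invr_ge0 ltW.
  have := Ei _ _ s^-1 0 Usx Mm0 si0 (lexx 0).
  by rewrite scale0r !subr0 scalerA mulVf ?gt_eqF// scale1r.
have E0 : E (0, 0).
  by have := Ei _ _ 0 0 U0 Mm0; rewrite !scale0r !subr0; apply.
have [l lE] := hahn_banach_cone Econe E0 Etot.
exists l => [|m Mm].
  apply: (linear_bounded_continuous nU) => u Uu; apply: lE.
  by have := Ei _ _ 1 0 Uu Mm0; rewrite scale0r scale1r !subr0; apply.
have := Ei _ _ 0 1 U0 Mm; rewrite scale0r scale1r !sub0r => /(_ _ _)/lE.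
by rewrite linearN /= lerN2; apply.
Qed.

(** A tube argument: continuity of addition at [(a, 0)] avoids [B] locally, and compactness of [A]
    makes the neighbourhood of [0] uniform in [a]. *)
Lemma compact_closed_nbhs0 (R : realType) (Y : tvsType R) (A B : set Y) :
  compact A -> closed B -> A `&` B = set0 ->
  \forall u \near (0 : Y), A `<=` [set a | ~ B (a + u)].
Proof.
move=> /compact_near_coveringP cA clB AB.
apply: cA => a Aa.
have nBa : nbhs (a + 0) (~` B).
  rewrite addr0; apply: open_nbhs_nbhs; split; first exact: closed_openC.
  by move=> Ba; have : (A `&` B) a by []; rewrite AB.
exact: (@add_continuous Y (a, 0) _ nBa).
Qed.

(** Compactness and local convexity give a convex open neighbourhood of [0] disjoint from the
    difference set [M] of [B] and [A]. A functional that is at least 1 on [M] leaves a gap of 1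
    between [A] and [B]. *)
Lemma strict_separation (R : realType) (Y : tvsType R) (A B : set Y) :
  convex_set (A : set (convex_lmodType Y)) ->
  convex_set (B : set (convex_lmodType Y)) ->
  compact (closure A) -> closure B `&` closure A = set0 ->
  A !=set0 -> B !=set0 ->
  exists2 l : {linear Y -> R^o}, continuous (l : Y -> R^o) &
    forall a b, A a -> B b -> l a + 1 <= l b.
Proof.
move=> cA cB kA AB [a0 Aa0] [b0 Bb0].
have := compact_closed_nbhs0 kA (@closed_closure _ B) _.
rewrite setIC => /(_ AB) nV.
have [BB BBc [BBo /(_ 0 _ nV)/=[U [BU U0] UV]]] := @locally_convex R Y.
pose M := [set b - a | a in A & b in B].
have cM : convex_set (M : set (convex_lmodType Y)).
  move=> y1 y2 t /set_mem + /set_mem +; move=> [a1 Aa1 [b1 Bb1 <-]].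
  move=> [a2 Aa2 [b2 Bb2 <-]]; apply/mem_set.
  exists (conv t (a1 : convex_lmodType Y) a2).
    by apply/set_mem/cA; exact/mem_set.
  exists (conv t (b1 : convex_lmodType Y) b2).
    by apply/set_mem/cB; exact/mem_set.
  by rewrite /conv/= !scalerBr opprD addrACA.
have [|||l lc lM] := separation_nbhs0 (BBc _ (mem_set BU)) cM.
- by apply: open_nbhs_nbhs; split => //; exact: BBo.
- apply/seteqP; split => // y [Uba [a Aa [b Bb baE]]].
  apply: (UV _ Uba a); first exact: subset_closure.
  by rewrite -baE addrC subrK; exact: subset_closure.
- by exists (b0 - a0), a0 => //; exists b0.
exists l => // a b Aa Bb; have /lM : M (b - a) by exists a => //; exists b.
by rewrite linearB/=; lra.
Qed.

(** * Cones and their bases *)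

Lemma normalize_base (R : realType) (Y : lmodType R) (psi : Y -> R) (M : set Y) :
  seminorm psi -> is_cone M ->
  forall y, M y -> 0 < psi y -> base M psi ((psi y)^-1 *: y).
Proof.
move=> [_ psiZ] [_ ME] y My psiy; split.
  by rewrite ME; exists (psi y)^-1; [rewrite /= invr_ge0 ltW|exists y].
by rewrite psiZ ger0_norm ?invr_ge0 ?ltW// mulVf// gt_eqF.
Qed.

Lemma is_coneN (R : realType) (Y : lmodType R) (M : set Y) :
  is_cone M -> is_cone (-%R @` M).
Proof.
move=> [M0 ME]; split; first by exists 0; rewrite ?oppr0.
apply/seteqP; split=> [_ [y My <-]|_ [t t0 [_ [y My <-] <-]]].
  by exists 1 => //=; exists (- y); [exists y|rewrite scale1r].
by exists (t *: y); [rewrite ME; exists t => //; exists y|rewrite scalerN].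
Qed.

Definition convex_cone (R : realType) (Y : lmodType R) (C : set Y) : Prop :=
  (forall y z, C y -> C z -> C (y + z)) /\
  (forall t y, 0 <= t -> C y -> C (t *: y)).

Lemma bp_cone_convex_cone (R : realType) (Y : tvsType R) (psi : Y -> R)
    (p : {linear Y -> R^o} * R) :
  seminorm psi -> 0 <= p.2 -> convex_cone (bp_cone psi p).
Proof.
move=> [psiD psiZ] p2; split=> [y z|t y t0]; rewrite /bp_cone /=.
  rewrite linearD /= => Cy Cz.
  by apply: le_trans (lerD Cy Cz); rewrite -mulrDr ler_wpM2l.
by rewrite psiZ ger0_norm// linearZ /= mulrCA; exact: ler_wpM2l.
Qed.

Lemma convex_cone0 (R : realType) (Y : lmodType R) (C : set Y) y :
  convex_cone C -> C y -> C 0.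
Proof. by move=> [_ CZ] Cy; rewrite -(scale0r y); exact: CZ. Qed.

Lemma lineality_notin (R : realType) (Y : lmodType R) (C : set Y) k :
  (C `\` lineality C) k -> ~ C (- k).
Proof.
by move=> [Ck nlk] CNk; apply: nlk; split => //; exists (- k); rewrite ?opprK.
Qed.

(** * Efficiency and scalarization *)

Lemma Eff_eq (R : realType) (X : Type) (Y : tvsType R) (Omega : set X)
    (f : X -> Y) (C : set Y) xbar x :
  Eff Omega f C xbar -> Omega x -> C (f xbar - f x) -> f x = f xbar.
Proof.
move=> [_ eff] Ox Cx; apply: contrapT => fx; apply: eff; exists x => //.
exists (f xbar - f x); last by rewrite opprB addrC subrK.
by split => //= /subr0_eq /esym.
Qed.

Section scalarization.
Context (R : realType) (X : Type) (Y : tvsType R).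
Variables (Omega : set X) (f : X -> Y) (C : set Y) (xbar : X) (a k : Y) (s : R).
Hypotheses (hC : convex_cone C) (heff : Eff Omega f C xbar).
Hypotheses (hk : (C `\` lineality C) k) (fxbar : f xbar = a + s *: k).

Lemma cone_scale_ge0 t : C (t *: k) -> 0 <= t.
Proof.
move=> Ctk; rewrite leNgt; apply/negP => t0; apply: (lineality_notin hk).
have := hC.2 (- t)^-1 _ _ Ctk; rewrite invr_ge0 oppr_ge0 ltW// => /(_ isT).
by rewrite scalerA invrN mulNr mulVf ?lt_eqF// scaleN1r.
Qed.

Lemma Eff_shift x t : Omega x -> C (t *: k + a - f x) -> t <= s ->
  f x = f xbar /\ t = s.
Proof.
move=> Ox Cx ts.
have fx : f x = f xbar.
  apply: (Eff_eq heff Ox); rewrite fxbar.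
  have -> : a + s *: k - f x = (t *: k + a - f x) + (s - t) *: k.
    by rewrite scalerBl [RHS]addrC !addrA subrK (addrC a).
  by apply: hC.1 => //; apply: hC.2; [rewrite subr_ge0|exact: hk.1].
split => //; apply/le_anti; rewrite ts /= -subr_ge0; apply: cone_scale_ge0.
by move: Cx; rewrite fx fxbar scalerBl opprD addrA addrK.
Qed.

(** Feasibility of [(x, t)] means [C (t *: k + a - f x)]. By [Eff_shift] no feasible level lies
    below [s], and level [s] is feasible exactly where [f x = f xbar]. *)
Lemma ps_solutions_Eff (phi : Y -> R) : minus_representing C phi ->
  [set (x, s) | x in [set x | Omega x /\ f x = f xbar]]
    = ps_solutions Omega f phi a k.
Proof.
move=> hphi.
have phiE x t : (phi (f x - a - t *: k) <= 0) = C (t *: k + a - f x) :> Prop.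
  have -> : t *: k + a - f x = - (f x - a - t *: k).
    by rewrite !opprB addrA.
  have := congr1 (fun S => S (f x - a - t *: k)) hphi => /= <-.
  apply/propext; split=> [[c Cc <-]|Cc]; first by rewrite opprK.
  by eexists; [exact: Cc|rewrite opprK].
have fsbl x : f x = f xbar -> C (s *: k + a - f x).
  by move=> ->; rewrite fxbar (addrC a) subrr; exact: convex_cone0 hC hk.1.
apply/seteqP; split=> [_ [x [Ox fx] <-]|[x t] [[/= Ox]]].
  split; first by split=> //=; rewrite phiE; exact: fsbl.
  move=> [y t] [/= Oy]; rewrite phiE => Cy; rewrite leNgt; apply/negP => ts.
  by have [_ tE] := Eff_shift Oy Cy (ltW ts); rewrite tE ltxx in ts.
rewrite phiE => Cx /(_ (xbar, s)) /= tmin.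
have ts : t <= s.
  by apply: tmin; split; [exact: heff.1|rewrite /= phiE; exact: fsbl].
by have [fx ->] := Eff_shift Ox Cx ts; exists x.
Qed.

(** Brings the infimum to the membership condition handled by [Eff_shift]. *)
Lemma gerstewitzE y : gerstewitz [set a - c | c in C] k y =
  ereal_inf [set t%:E | t in [set t : R | C (t *: k + a - y)]].
Proof.
congr (ereal_inf [set t%:E | t in _]); apply/seteqP; split=> t /=.
  by move=> [_ [c Cc <-] <-]; rewrite addrA subKr.
move=> Cc; exists (a - (t *: k + a - y)); first by eexists; [exact: Cc|].
by rewrite addrA subKr.
Qed.

Lemma gerstewitz_ge x : Omega x ->
  (s%:E <= (gerstewitz [set a - c | c in C] k (f x))%R)%E.
Proof.
move=> Ox; rewrite gerstewitzE; apply/ereal_infP => _ [t /= Ct <-].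
rewrite lee_fin leNgt; apply/negP => ts.
by have [_ tE] := Eff_shift Ox Ct (ltW ts); rewrite tE ltxx in ts.
Qed.

Lemma gerstewitz_Eff : gerstewitz [set a - c | c in C] k (f xbar) = s%:E.
Proof.
apply/le_anti; rewrite (gerstewitz_ge heff.1) andbT gerstewitzE.
apply: ereal_inf_lbound; exists s => //=.
by rewrite fxbar (addrC a) subrr; exact: convex_cone0 hC hk.1.
Qed.

(** The infimum is not assumed to be attained, so closedness is used: if [f xbar - f x] were outside
    [C], so would be [f xbar - f x + e *: k] for some [e > 0]. Yet some level [t < s + e] is
    admissible, and adding [(s + e - t) *: k] puts that point in [C]. *)
Lemma gerstewitz_le x : closed C -> Omega x ->
  ((gerstewitz [set a - c | c in C] k (f x))%R <= s%:E)%E -> f x = f xbar.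
Proof.
move=> clC Ox; rewrite gerstewitzE => Gs.
apply: (Eff_eq heff Ox); apply: contrapT => nC.
have [|e e0 nCe] := nbhs0_absorbing (compact_closed_nbhs0
  (@compact_set1 _ (f xbar - f x)) clC _) k.
  by apply/seteqP; split=> // _ [-> /nC].
case: (nCe _ (erefl _)).
have /(le_lt_trans Gs) : (s%:E < (s + e)%:E)%E by rewrite lte_fin ltrDl.
move=> /ereal_inf_lt[_ [t /= Ct <-]]; rewrite lte_fin => ts.
have -> : f xbar - f x + e *: k = (t *: k + a - f x) + (s + e - t) *: k.
  rewrite fxbar scalerBl scalerDl [RHS]addrC !addrA subrK.
  by rewrite (addrC (_ + _) a) addrA [LHS]addrAC.
by apply: hC.1 => //; apply: hC.2; [lra|exact: hk.1].
Qed.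

Lemma argmin_gerstewitz_Eff : closed C ->
  [set x | Omega x /\ f x = f xbar] =
  argmin Omega (fun x => gerstewitz [set a - c | c in C] k (f x)).
Proof.
move=> clC; apply/seteqP; split=> x /= [Ox].
  by move=> fx; split=> // y Oy; rewrite fx gerstewitz_Eff; exact: gerstewitz_ge.
move=> /(_ _ heff.1); rewrite gerstewitz_Eff => Gs.
by split=> //; exact: gerstewitz_le.
Qed.

End scalarization.

(** A nonpositive value of [phi (f x - f xbar)] puts [f xbar - f x] in [C], so [f x = f xbar] by
    efficiency; the minimum is therefore [phi 0 = 0]. *)
Lemma argmin_representing (R : realType) (X : Type) (Y : tvsType R)
    (Omega : set X) (f : X -> Y) (C : set Y) (xbar : X) (phi : Y -> R) :
  Eff Omega f C xbar -> phi 0 = 0 -> minus_representing C phi ->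
  [set x | Omega x /\ f x = f xbar] = argmin Omega (fun x => phi (f x - f xbar)).
Proof.
move=> heff phi0 hphi.
have fxE x : Omega x -> phi (f x - f xbar) <= 0 -> f x = f xbar.
  move=> Ox phix; apply: (Eff_eq heff Ox).
  have [c Cc cE] : (-%R @` C) (f x - f xbar) by rewrite hphi.
  by rewrite -opprB -cE opprK.
apply/seteqP; split=> x /= [Ox].
  move=> fx; split=> // y Oy; rewrite fx subrr phi0 leNgt; apply/negP => yneg.
  by move: (yneg); rewrite (fxE _ Oy (ltW yneg)) subrr phi0 ltxx.
move=> /(_ _ heff.1); rewrite subrr phi0 => phix.
by split=> //; exact: fxE.
Qed.

(** * The separating Bishop-Phelps cone and the theorem *)

Lemma Eff_antimono (R : realType) (X : Type) (Y : tvsType R) (Omega : set X)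
    (f : X -> Y) (C D : set Y) :
  C `\ 0 `<=` D -> Eff Omega f D `<=` Eff Omega f C.
Proof.
move=> CD x [Ox nx]; split=> // -[y Oy [c Cc cE]]; apply: nx; exists y => //.
by exists c => //; split; [exact: CD|exact: Cc.2].
Qed.

Lemma bp_cone_separating (R : realType) (Y : tvsType R) (psi : Y -> R)
    (K M : set Y) :
  seminorm psi -> normlike_base K psi -> normlike_base M psi ->
  compact (closure (conv_base (-%R @` K) psi)) ->
  closure (conv_base0 M psi) `&` closure (conv_base (-%R @` K) psi) = set0 ->
  exists p : {linear Y -> R^o} * R,
    [/\ aug_dual_sharp K psi p, 0 < p.2 &
        forall y, (bp_cone psi p `\ 0) y -> ~ M (- y)].
Proof.
move=> hpsi [[Kc [K0 _]] Kpos] [[Mc _] Mpos] kK KM.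
have NKc := is_coneN Kc.
have psiN y : psi (- y) = psi y by rewrite -scaleN1r hpsi.2 normrN1 mul1r.
have bK y : K y -> y <> 0 -> base (-%R @` K) psi ((psi y)^-1 *: - y).
  move=> Ky y0; rewrite -psiN; apply: normalize_base => //.
  by rewrite psiN; exact: Kpos.
have [y0 Ky0 y0n0] : exists2 y, K y & y <> 0.
  apply: contrapT => nK; apply: K0; apply/seteqP; split=> y /=.
    by move=> Ky; apply: contrapT => yn0; apply: nK; exists y.
  by move=> ->; exact: Kc.1.
have S0 : conv_base0 M psi 0 by apply: sub_conv; left.
have Sa := sub_conv (bK _ Ky0 y0n0).
have [||l lc lsep] := strict_separation (@conv_convex _ _ _)
  (@conv_convex _ _ _) kK KM.
- by eexists; exact: Sa.
- by exists 0.
pose b := inf [set l y | y in conv_base0 M psi].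
have hb : has_lbound [set l y | y in conv_base0 M psi].
  by exists (l ((psi y0)^-1 *: - y0) + 1) => _ [y My <-]; exact: lsep.
have lb y : conv_base0 M psi y -> b <= l y.
  by move=> My; apply: ge_inf => //; exists y.
have la y : conv_base (-%R @` K) psi y -> l y + 1 <= b.
  move=> Ky; apply: lb_le_inf; first by exists (l 0), 0.
  by move=> _ [z Mz <-]; exact: lsep.
(* The point [0] adjoined to the base of [M] is what makes [alpha] positive. *)
have b0 : b <= 0 by have := lb _ S0; rewrite linear0.
(* - alpha lies halfway between b - 1 >= sup l (S_{-K}) and b = inf l (S^0_M). *)
exists (l, 1 / 2 - b); split=> /=.
- split; first by split => //=; lra.
  move=> y [Ky yn0]; have psiy := Kpos _ Ky yn0.
  have := la _ (sub_conv (bK _ Ky yn0)).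
  rewrite linearZ linearN /= -[_ *: _]/(_ * _) mulrN => lay.
  have : 1 / 2 - b < (psi y)^-1 * l y by lra.
  by rewrite ltr_pdivlMl// subr_gt0 mulrC.
- lra.
- move=> y [Cy yn0] My.
  have psiy : 0 < psi (- y) by apply: Mpos => // /eqP; rewrite oppr_eq0 => /eqP.
  (* Normalizing [- y] gives [l y <= - b * psi y], against [(1 / 2 - b) * psi y <= l y] with
     [psi y > 0]. *)
  have := lb _ (sub_conv (or_intror (normalize_base hpsi Mc My psiy))).
  rewrite linearZ linearN /= -[_ *: _]/(_ * _) mulrN lerNr ler_pdivrMl// psiN.
  rewrite psiN in psiy; move: Cy; rewrite /bp_cone /=; nra.
Qed.

Unset Implicit Arguments.

Theorem theorem37 (R : realType) (X : topologicalLmodType R) (Y : tvsType R)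
    (Omega : set X) (f : X -> Y) (K : set Y) (xbar : X) (D : set Y)
    (psi : Y -> R)
    (hOmega : Omega !=set0)
    (hK : nontrivial_cone K)
    (hxbar : PEff_He Omega f K xbar)
    (hD : dilating_cones K D)
    (hxbarD : Eff Omega f D xbar)
    (hDclosed : closed D)
    (hpsi : seminorm psi)
    (hpsi_cont : continuous psi)
    (hKbase : normlike_base K psi)
    (hDbase : normlike_base (~` (-%R @` D°)) psi)
    (hcompact : compact (closure (conv_base (-%R @` K) psi)))
    (hdisj : closure (conv_base0 (~` (-%R @` D°)) psi)
               `&` closure (conv_base (-%R @` K) psi) = set0) :
  exists p : {linear Y -> R^o} * R,
    let C := bp_cone psi p in
    [/\ (aug_dual_sharp K psi
           `&` (@top_dual R Y `*` [set alpha | 0 < alpha])) p,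
        Eff Omega f C xbar &
        C <> lineality C ->
        forall phi : Y -> R,
        sublinear phi -> phi 0 = 0 -> minus_representing C phi ->
        [/\ (* (i) *)
            forall k, (C `\` lineality C) k ->
              [set (x, 0 : R) | x in [set x | Omega x /\ f x = f xbar]]
                = ps_solutions Omega f phi (f xbar) k,
            (* (ii) *)
            [set x | Omega x /\ f x = f xbar]
              = argmin Omega (fun x => phi (f x - f xbar)),
            (* (iii) *)
            forall (P T : set Y) (S : set R),
              T `<=` C `\` lineality C ->
              f @` Eff Omega f C
                `<=` [set a + y | a in P & y in [set s *: k | s in S & k in T]] ->
              exists a k s, [/\ P a, T k, S s &
                [set (x, s) | x in [set x | Omega x /\ f x = f xbar]]
                  = ps_solutions Omega f phi a k] &
            (* (iv) *)
            forall (P T : set Y) (S : set R),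
              T `<=` C `\` lineality C ->
              f @` Eff Omega f C
                `<=` [set a + y | a in P & y in [set s *: k | s in S & k in T]] ->
              closed C ->
              exists a k s, [/\ P a, T k, S s,
                gerstewitz [set a - c | c in C] k (f xbar) = s%:E &
                [set x | Omega x /\ f x = f xbar]
                  = argmin Omega
                      (fun x => gerstewitz [set a - c | c in C] k (f x))]]].
Proof.
have [p [psharp p2 pM]] := bp_cone_separating hpsi hKbase hDbase hcompact hdisj.
have CD : bp_cone psi p `\ 0 `<=` D.
  (* Here [M] is the complement of [- int D], so [- y] outside [M] means [y] in [int D]. *)
  move=> y /pM /contrapT [d Dd /oppr_inj <-]; exact: interior_subset.
have heff := Eff_antimono CD hxbarD.
have hC := bp_cone_convex_cone hpsi (ltW p2).
exists p; split=> //; first by split=> //; split=> //; case: psharp => -[].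
move=> _ phi _ phi0 hphi.
(* Since [xbar] is efficient, the covering hypothesis of (iii) and (iv) applies to [f xbar] and
   supplies [a], [k], [s]. *)
have xbar_in (P T : set Y) (S : set R) :
    f @` Eff Omega f (bp_cone psi p)
      `<=` [set a + y | a in P & y in [set s *: k | s in S & k in T]] ->
    exists a k s, [/\ P a, T k, S s & f xbar = a + s *: k].
  move=> /(_ (f xbar)) []; first by exists xbar.
  by move=> a Pa [_ [s Ss [k Tk <-]] <-]; exists a, k, s.
split.
(* The case [a = f xbar], [s = 0]. *)
- move=> k hk; apply: (ps_solutions_Eff hC heff hk _ hphi).
  by rewrite scale0r addr0.
- exact: (argmin_representing heff phi0 hphi).
- move=> P T S TC /xbar_in [a [k [s [Pa Tk Ss fE]]]]; exists a, k, s; split=> //.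
  exact: (ps_solutions_Eff hC heff (TC _ Tk) fE hphi).
- move=> P T S TC /xbar_in [a [k [s [Pa Tk Ss fE]]]] clC.
  exists a, k, s; split=> //.
    exact: (gerstewitz_Eff hC heff (TC _ Tk) fE).
  exact: (argmin_gerstewitz_Eff hC heff (TC _ Tk) fE clC).
Qed.
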